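(* Let $1\le k\le n$ and let $D\in\mathcal E^n$ have embedding dimension $r$. Let $\bar D:=D[1\!:\!k]\in\mathcal E^k$ have embedding dimension $t$, and let $B:=\mathcal K^\dagger(\bar D)=\bar U_B S\bar U_B^T$, where $\bar U_B\in\mathcal M^{k\times t}$, $\bar U_B^T\bar U_B=I_t$, and $S\in\mathcal S^t_{++}$. Furthermore, let $U_B:=\begin{bmatrix}\bar U_B & \frac1{\sqrt k}e\end{bmatrix}\in\mathcal M^{k\times(t+1)}$, let $U:=\begin{bmatrix}U_B&0\\0&I_{n-k}\end{bmatrix}\in\mathcal M^{n\times(n-k+t+1)}$, and let $\begin{bmatrix}V&\frac{U^Te}{\|U^Te\|}\end{bmatrix}\in\mathcal M^{n-k+t+1}$ be orthogonal. Then $$\operatorname{face}\,\mathcal K^\dagger\left(\mathcal E^n(1\!:\!k,\bar D)\right)=\left(U\,\mathcal S_+^{n-k+t+1}\,U^T\right)\cap\mathcal S_C=(UV)\,\mathcal S_+^{n-k+t}\,(UV)^T.$$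
   Context: Notation. $\mathcal S^n$ is the space of real symmetric $n\times n$ matrices with inner product $\langle A,B\rangle=\operatorname{trace}AB$; $\mathcal S^n_+$, $\mathcal S^n_{++}$ are the positive semidefinite and positive definite matrices in $\mathcal S^n$. $\mathcal M^{p\times q}$ is the space of real $p\times q$ matrices and $\mathcal M^p=\mathcal M^{p\times p}$. $e$ is the all-ones vector of appropriate dimension, and $1\!:\!k=\{1,\dots,k\}$. For $\alpha\subseteq 1\!:\!n$, $Y[\alpha]$ is the principal submatrix of $Y$ with rows and columns indexed by $\alpha$. Euclidean distance matrices. $D\in\mathcal S^n$ is a Euclidean distance matrix (EDM) if there are an integer $r\ge0$ and points $p_1,\dots,p_n\in\mathbb R^r$ with $D_{ij}=\|p_i-p_j\|_2^2$ for all $i,j$ (squared distances); the smallest such $r$ is the embedding dimension of $D$. $\mathcal E^n\subset\mathcal S^n$ is the cone of $n\times n$ EDMs. For $\alpha\subseteq1\!:\!n$ with $|\alpha|=k$ and $\bar D\in\mathcal E^k$, $\mathcal E^n(\alpha,\bar D):=\{D\in\mathcal E^n: D[\alpha]=\bar D\}$. Operators. $\mathcal K:\mathcal S^n\to\mathcal S^n$ is $\mathcal K(Y)=\operatorname{diag}(Y)e^T+e\operatorname{diag}(Y)^T-2Y$, where $\operatorname{diag}(Y)$ is the vector of diagonal entries of $Y$. Its Moore–Penrose generalized inverse is $\mathcal K^\dagger(D)=-\frac12J\,\mathrm{offDiag}(D)\,J$, where $J=I-\frac1nee^T$ and $\mathrm{offDiag}(D)$ is $D$ with its diagonal replaced by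 zeros. The same symbols are used for matrices of any order (with $n$ replaced by the order). $\mathcal S_C=\{Y\in\mathcal S^n:Ye=0\}$. Faces. For a convex cone $K$, $F\subseteq K$ is a face of $K$ if $x,y\in K$ and $\frac12(x+y)\in F$ imply that the convex cone generated by $\{x,y\}$ is contained in $F$. For $S\subseteq\mathcal S^n_+$, $\operatorname{face}(S)$ is the smallest face of $\mathcal S^n_+$ containing $S$. $U\mathcal S^m_+U^T:=\{UZU^T: Z\in\mathcal S^m_+\}$. *)

(* Defs.v *)
From mathcomp Require Import all_boot all_order all_algebra.
From mathcomp Require Import ring lra.
From mathcomp Require Import mathcomp_extra boolp classical_sets reals.

Set Implicit Arguments.
Unset Strict Implicit.
Unset Printing Implicit Defensive.

Import Order.TTheory GRing.Theory Num.Theory.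

Local Open Scope classical_set_scope.
Local Open Scope ring_scope.

(* Euclidean norm; the library's norm on matrices is the max norm. *)
Definition l2norm (R : realType) (n : nat) (x : 'cV[R]_n) : R :=
  Num.sqrt (\sum_i x i 0 ^+ 2).

Definition onesv (R : realType) (n : nat) : 'cV[R]_n := const_mx 1.

Definition symm (R : realType) (n : nat) : set 'M[R]_n :=
  [set A | A^T = A].

Definition psd (R : realType) (n : nat) : set 'M[R]_n :=
  [set A | symm A /\ forall x : 'cV[R]_n, 0 <= (x^T *m A *m x) 0 0].

Definition posdef (R : realType) (n : nat) : set 'M[R]_n :=
  [set A | symm A /\
     forall x : 'cV[R]_n, x != 0 -> 0 < (x^T *m A *m x) 0 0].

Definition centered (R : realType) (n : nat) : set 'M[R]_n :=
  [set Y | symm Y /\ Y *m onesv R n = 0].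

Definition realizable (R : realType) (n : nat) (D : 'M[R]_n) (r : nat) :=
  exists p : 'I_n -> 'cV[R]_r, forall i j, D i j = l2norm (p i - p j) ^+ 2.

Definition edm (R : realType) (n : nat) : set 'M[R]_n :=
  [set D | exists r, realizable D r].

Definition embedding_dim (R : realType) (n : nat) (D : 'M[R]_n) (r : nat) :=
  realizable D r /\ forall s, realizable D s -> (r <= s)%N.

(* With n = k + m, the principal submatrix D[1:k] is the upper left k x k
   block of D, so this is the set E^n(1:k, Dbar). *)
Definition edm_completions (R : realType) (k m : nat) (Dbar : 'M[R]_k) :
    set 'M[R]_(k + m) :=
  [set D | edm D /\ ulsubmx D = Dbar].

Definition diagv (R : realType) (n : nat) (Y : 'M[R]_n) : 'cV[R]_n :=
  \col_i Y i i.

Definition offDiag (R : realType) (n : nat) (D : 'M[R]_n) : 'M[R]_n :=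
  \matrix_(i, j) if i == j then 0 else D i j.

Definition edmK (R : realType) (n : nat) (Y : 'M[R]_n) : 'M[R]_n :=
  diagv Y *m (onesv R n)^T + onesv R n *m (diagv Y)^T - 2 *: Y.

Definition centering (R : realType) (n : nat) : 'M[R]_n :=
  1%:M - n%:R^-1 *: (onesv R n *m (onesv R n)^T).

(* The Moore-Penrose inverse of edmK on symmetric matrices; the Penrose
   conditions are checked in edmKdag_penrose below. *)
Definition edmKdag (R : realType) (n : nat) (D : 'M[R]_n) : 'M[R]_n :=
  - (2^-1 *: (centering R n *m offDiag D *m centering R n)).

Definition conic_hull2 (R : realType) (V : lmodType R) (x y : V) : set V :=
  [set z | exists a b : R, [/\ 0 <= a, 0 <= b & z = a *: x + b *: y]].

(* F need not be convex.  A convex set that is the smallest such F above S is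
   a fortiori the smallest convex one. *)
Definition is_face (R : realType) (V : lmodType R) (K F : set V) :=
  F `<=` K /\
  forall x y, K x -> K y -> F (2^-1 *: (x + y)) -> conic_hull2 x y `<=` F.

Definition face (R : realType) (n : nat) (S : set 'M[R]_n) : set 'M[R]_n :=
  smallest (is_face (@psd R n)) S.

Definition congr_psd (R : realType) (n m : nat) (U : 'M[R]_(n, m)) :
    set 'M[R]_n :=
  [set U *m Z *m U^T | Z in @psd R m].

(* Two-sided, hence it forces p = q; this allows the two dimensions of an
   orthogonal block matrix to be equal without being convertible. *)
Definition orthogonal_mx (R : realType) (p q : nat) (W : 'M[R]_(p, q)) :=
  W^T *m W = 1%:M /\ W *m W^T = 1%:M.

Lemma psd_is_face (R : realType) (n : nat) :
  is_face (@psd R n) (@psd R n).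
Proof.
split; first by [].
move=> x y [sx px] [sy py] _ z [a [b [a0 b0 ->]]]; split.
  by rewrite /symm /= linearD /= !linearZ /= (sx : _^T = _) (sy : _^T = _).
move=> v; rewrite mulmxDr mulmxDl -!scalemxAr -!scalemxAl.
by rewrite mxE addr_ge0 // mxE mulr_ge0.
Qed.

Lemma face_is_face (R : realType) (n : nat) (S : set 'M[R]_n) :
  S `<=` @psd R n -> is_face (@psd R n) (face S).
Proof.
move=> SK; split; first by apply: smallest_sub => //; exact: psd_is_face.
move=> x y Kx Ky Fxy z xyz F [[FK Fface] SF].
by apply: (Fface x y) xyz => //; exact: Fxy.
Qed.

Section Penrose.
Variables (R : realType) (n : nat).
Hypothesis n_gt0 : (0 < n)%N.
Implicit Types D Y : 'M[R]_n.
Local Notation J := (centering R n).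
Local Notation e := (onesv R n).

Let n_neq0 : n%:R != 0 :> R.
Proof. by rewrite pnatr_eq0 -lt0n. Qed.

Lemma centering_tr : J^T = J.
Proof. by rewrite /centering linearB /= linearZ /= trmx1 trmx_mul trmxK. Qed.

Lemma centering_ones : J *m e = 0.
Proof.
rewrite mulmxBl mul1mx -scalemxAl -mulmxA.
have -> : e^T *m e = n%:R%:M.
  apply/matrixP => i j; rewrite !ord1 !mxE (eq_bigr (fun=> 1)).
    by rewrite sumr_const card_ord.
  by move=> l _; rewrite !mxE mulr1.
by rewrite mul_mx_scalar scalerA mulVf // scale1r subrr.
Qed.

Lemma centering_idem : J *m J = J.
Proof.
rewrite {2}/centering mulmxBr mulmx1 -scalemxAr mulmxA centering_ones.
by rewrite mul0mx scaler0 subr0.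
Qed.

Lemma offDiag_edmK Y : offDiag (edmK Y) = edmK Y.
Proof.
apply/matrixP => i j; rewrite mxE; case: eqP => // ->.
by rewrite !mxE !big_ord1 !mxE; ring.
Qed.

Lemma edmKdag_edmK Y : edmKdag (edmK Y) = J *m Y *m J.
Proof.
have eJ : e^T *m J = 0.
  by rewrite -centering_tr -trmx_mul centering_ones trmx0.
rewrite /edmKdag offDiag_edmK.
have -> : J *m edmK Y *m J = - (2 *: (J *m Y *m J)).
  move: eJ centering_ones; move: (centering R n) => H eH He.
  rewrite /edmK mulmxBr mulmxDr !mulmxBl mulmxDl -!mulmxA eH !mulmx0.
  rewrite [H *m (e *m _)]mulmxA He mul0mx addr0 sub0r.
  by rewrite -!(scalemxAl, scalemxAr).
by rewrite scalerN opprK scalerA mulVf ?scale1r // pnatr_eq0.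
Qed.

Lemma edmK_edmKdag D : symm D -> edmK (edmKdag D) = offDiag D.
Proof.
move=> sD; set O := offDiag D.
have sO i j : O i j = O j i.
  by rewrite !mxE eq_sym; case: eqP => // _; rewrite -{1}(sD : _^T = _) mxE.
have OO i : O i i = 0 by rewrite mxE eqxx.
pose a i := n%:R^-1 * \sum_l O l i.
have JM (M : 'M[R]_n) i j : (J *m M) i j = M i j - n%:R^-1 * \sum_l M l j.
  rewrite {1}/centering mulmxBl mul1mx -scalemxAl -mulmxA.
  rewrite [LHS]mxE; congr (_ + _); rewrite [LHS]mxE; congr (- _).
  rewrite [LHS]mxE; congr (_ * _); rewrite [LHS]mxE big_ord1 !mxE mul1r.
  by apply: eq_bigr => l _; rewrite !mxE mul1r.
have JOJ i j : (J *m O *m J) i j = O i j - a j - (a i - n%:R^-1 * \sum_l a l).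
  have -> : J *m O *m J = (J *m (J *m O)^T)^T.
    by rewrite trmx_mul trmxK centering_tr.
  rewrite [LHS]mxE JM mxE JM; congr (_ - _).
  rewrite (eq_bigr (fun l => O i l - a l)) ?sumrB ?mulrBr; last first.
    by move=> l _; rewrite mxE JM.
  by congr (_ * _ - _); apply: eq_bigr => l _; exact: sO.
apply/matrixP => i j.
have E p q : edmKdag D p q =
    - (2^-1 * (O p q - a q - (a p - n%:R^-1 * \sum_l a l))).
  by rewrite -JOJ [LHS]mxE; congr (- _); rewrite [LHS]mxE.
have KE Y : edmK Y i j = Y i i + Y j j - 2 * Y i j.
  by rewrite !mxE !big_ord1 !mxE mulr1 mul1r.
by rewrite KE !E !OO; field.
Qed.

Lemma edmK_sym Y : symm Y -> symm (edmK Y).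
Proof.
move=> sY; rewrite /symm /edmK /= linearB linearD /= linearZ /= !trmx_mul.
by rewrite !trmxK (sY : _^T = _); congr (_ - _); exact: addrC.
Qed.

Lemma edmKdag_sym D : symm D -> symm (edmKdag D).
Proof.
move=> sD; rewrite /symm /edmKdag /= linearN /= linearZ /= !trmx_mul.
rewrite centering_tr mulmxA; congr (- (_ *: (_ *m _ *m _))).
apply/matrixP => i j; rewrite !mxE eq_sym; case: eqP => // _.
by rewrite -{1}(sD : _^T = _) mxE.
Qed.

Lemma edmKdag_penrose :
  [/\ forall Y : 'M[R]_n, symm Y -> edmK (edmKdag (edmK Y)) = edmK Y,
      forall D : 'M[R]_n, symm D -> edmKdag (edmK (edmKdag D)) = edmKdag D,
      forall A B : 'M[R]_n, symm A -> symm B ->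
        \tr (edmK (edmKdag A) *m B) = \tr (A *m edmK (edmKdag B)) &
      forall A B : 'M[R]_n, symm A -> symm B ->
        \tr (edmKdag (edmK A) *m B) = \tr (A *m edmKdag (edmK B))].
Proof.
split.
- by move=> Y sY; rewrite edmK_edmKdag ?offDiag_edmK //; exact: edmK_sym.
- move=> D sD; rewrite edmKdag_edmK /edmKdag mulmxN mulNmx -scalemxAr -scalemxAl.
  by rewrite !mulmxA centering_idem -!mulmxA centering_idem.
- move=> A B sA sB; rewrite !edmK_edmKdag // /mxtrace.
  apply: eq_bigr => i _; rewrite !mxE; apply: eq_bigr => j _; rewrite !mxE.
  by rewrite (eq_sym j); case: eqP; rewrite ?mul0r ?mulr0.
- move=> A B _ _; rewrite !edmKdag_edmK -!mulmxA mxtrace_mulC.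
  by rewrite -!mulmxA.
Qed.

End Penrose.

(* Main.v *)
Require Import Defs.
From mathcomp Require Import all_boot all_order all_algebra.
From mathcomp Require Import ring lra.
From mathcomp Require Import classical_sets reals.

Set Implicit Arguments.
Unset Strict Implicit.
Unset Printing Implicit Defensive.

Import Order.TTheory GRing.Theory Num.Theory.

Local Open Scope classical_set_scope.
Local Open Scope ring_scope.

(** Write [J] for the centering projection, [e] for the all-ones vector, and
    [X] for the image under [edmKdag] of the set of completions.

    Everything rests on Gram matrices.  A matrix is a distance matrix exactly
    when it is [edmK (P *m P^T)], the rows of [P] being the points
    ([realizableP]), and [edmKdag] then returns the Gram matrix of the points
    moved to their centroid, [Q *m Q^T] with [Q = J *m P] ([edmKdag_gram]).

    Upper bound.  If the first [k] points have distance matrix [Dbar], then,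
    centered on their own, they have Gram matrix [B], so the columns of their
    coordinate matrix lie in the range of [Ubar] ([gram_range]).  Translations
    add multiples of [e] and the other [m] points are free, hence [Q] factors
    through [U] and [X] lies in [congr_psd U `&` centered]
    ([edmKdag_completion_sub]).  Both parts of this intersection are faces,
    because each has the form [{Y psd | Y *m M = 0}] ([congr_psdE]), and such
    a set is a face: nonnegative quadratic forms with zero sum vanish, and a
    zero of a psd form is a null vector ([is_face_annihilated]).

    The second description.  If [Y = U *m Z *m U^T] kills [e], then [Z] kills
    [u = U^T *m e]; the columns of [V] span the orthogonal complement of [u],
    so [Z] is compressed by [V] without loss ([congr_psd_centered]).

    Lower bound.  Realize [Dbar] by [k] points in dimension [t] and place the
    other [m] points on [m] new coordinate axes.  This completion is spread
    out as far as possible: the columns of [U *m V] lie in the range of its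
    centered coordinate matrix [Q] ([spread_range], [centering_proj]).
    Therefore each [Y] in [congr_psd (U *m V)] is [Q *m M *m Q^T] for some
    [M].  The form of [Y] is then dominated by a multiple of that of
    [Q *m Q^T], so a positive multiple of [Y] and another psd matrix have
    midpoint [Q *m Q^T], and every face through [Q *m Q^T] contains [Y]
    ([face_mem_range]). *)

(** * Quadratic forms and positive semidefinite matrices *)

Lemma trmx_mul_self00 (R : realType) (n : nat) (x : 'cV[R]_n) :
  (x^T *m x) 0 0 = \sum_i x i 0 ^+ 2.
Proof. by rewrite mxE; apply: eq_bigr => i _; rewrite mxE expr2. Qed.

Lemma gram_ge0 (R : realType) (n : nat) (x : 'cV[R]_n) : 0 <= (x^T *m x) 0 0.
Proof. by rewrite trmx_mul_self00; apply: sumr_ge0 => i _; exact: sqr_ge0. Qed.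

Lemma gram_col_eq0 (R : realType) (n : nat) (x : 'cV[R]_n) :
  (x^T *m x) 0 0 = 0 -> x = 0.
Proof.
rewrite trmx_mul_self00 => /psumr_eq0P x0; apply/matrixP => i j.
rewrite ord1 mxE; apply/eqP; rewrite -sqrf_eq0; apply/eqP.
by apply: x0 => // l _; exact: sqr_ge0.
Qed.

Lemma quad_col (R : realType) (n p : nat) (Y : 'M[R]_n) (M : 'M[R]_(n, p)) j :
  ((col j M)^T *m Y *m col j M) 0 0 = (M^T *m Y *m M) j j.
Proof. by rewrite tr_col -row_mul colE mulmxA -row_mul -colE !mxE. Qed.

Lemma cols_eq0 (R : realType) (n p : nat) (M : 'M[R]_(n, p)) :
  (forall j, col j M = 0) -> M = 0.
Proof.
by move=> M0; apply/matrixP => i j; have /colP/(_ i) := M0 j; rewrite !mxE.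
Qed.

Lemma gram_eq0 (R : realType) (n p : nat) (M : 'M[R]_(n, p)) :
  M^T *m M = 0 -> M = 0.
Proof.
move=> M0; apply: cols_eq0 => j; apply: gram_col_eq0.
by rewrite -{1}[_^T]mulmx1 quad_col mulmx1 M0 mxE.
Qed.

(** The form is nonnegative along the line [x + s *: Y *m x]; there its
    constant term is zero, so its linear coefficient, which is twice
    the squared norm of [Y *m x], has to vanish. *)
Lemma psd_col_eq0 (R : realType) (n : nat) (Y : 'M[R]_n) (x : 'cV[R]_n) :
  psd Y -> (x^T *m Y *m x) 0 0 = 0 -> Y *m x = 0.
Proof.
move=> [sY pY] x0; apply: gram_col_eq0.
set z := Y *m x; set a := (z^T *m z) 0 0.
have a0 : 0 <= a by exact: gram_ge0.
set b := (z^T *m Y *m z) 0 0; have b0 : 0 <= b by exact: pY.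
have zxE : z^T *m Y *m x = z^T *m z by rewrite -mulmxA.
have xzE : x^T *m Y *m z = z^T *m z by rewrite /z trmx_mul (sY : _^T = _).
have q s : 0 <= s * (a *+ 2) + s ^+ 2 * b.
  have := pY (x + s *: z); rewrite !linearD /= linearZ /= !mulmxDl -!scalemxAl.
  rewrite -!scalemxAr zxE xzE.
  rewrite /a /b; move: (x^T *m Y *m x) x0 (z^T *m z) (z^T *m Y *m z).
  by move=> X X0 Z W; rewrite !mxE X0; lra.
apply/eqP; rewrite eq_le a0 andbT leNgt; apply/negP => agt0.
(* A small negative [s]: the minimizer [- a / b], with [b + 1] in place of [b]
   to allow for [b = 0]. *)
have := q (- (a / (b + 1))).
have b1 : 0 < b + 1 by lra.
have -> : - (a / (b + 1)) * (a *+ 2) + (- (a / (b + 1))) ^+ 2 * b =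
  - ((a / (b + 1)) ^+ 2 * (b + 2)) by field; lra.
rewrite oppr_ge0 leNgt => /negP; apply.
by rewrite mulr_gt0 ?exprn_gt0 ?divr_gt0 //; lra.
Qed.

Lemma psd_mulmx_eq0 (R : realType) (n p : nat) (Y : 'M[R]_n)
    (M : 'M[R]_(n, p)) :
  psd Y -> (forall j, (M^T *m Y *m M) j j = 0) -> Y *m M = 0.
Proof.
move=> pY M0; apply: cols_eq0 => j; rewrite colE -mulmxA -colE.
by apply: psd_col_eq0 => //; rewrite quad_col.
Qed.

Lemma psd_congr (R : realType) (n p : nat) (A : 'M[R]_(n, p)) (Z : 'M[R]_p) :
  psd Z -> psd (A *m Z *m A^T).
Proof.
move=> [sZ pZ]; split.
  by rewrite /symm /= !trmx_mul trmxK (sZ : _^T = _) mulmxA.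
by move=> x; have := pZ (A^T *m x); rewrite trmx_mul trmxK !mulmxA.
Qed.

Lemma psd1 (R : realType) (n : nat) : psd (1%:M : 'M[R]_n).
Proof.
split; first by rewrite /symm /= trmx1.
by move=> x; rewrite mulmx1; exact: gram_ge0.
Qed.

Lemma psd_gram (R : realType) (n p : nat) (A : 'M[R]_(n, p)) : psd (A *m A^T).
Proof. by rewrite -{1}[A]mulmx1; apply: psd_congr; exact: psd1. Qed.

(** A Gram matrix has the same range as its factor: [Q^T *m N] has Gram matrix
    [N^T *m (Q *m Q^T) *m N], so whatever [A^T] annihilates, [Q^T] does too. *)
Lemma gram_range (R : realType) (n p q : nat) (Q : 'M[R]_(n, p))
    (A : 'M[R]_(n, q)) (M : 'M[R]_(q, n)) :
  Q *m Q^T = A *m M -> exists W, Q = A *m W.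
Proof.
move=> QA; have : Q^T *m cokermx A^T = 0.
  apply: gram_eq0; rewrite trmx_mul trmxK -mulmxA (mulmxA Q).
  have -> : Q *m Q^T = M^T *m A^T by rewrite -trmx_mul -QA trmx_mul trmxK.
  by rewrite -(mulmxA M^T) mulmx_coker !mulmx0.
move/eqP; rewrite -submxE => /submxP[W QW]; exists W^T.
by rewrite -[LHS]trmxK QW trmx_mul trmxK.
Qed.

(** A nonzero kernel vector would be a zero of the form. *)
Lemma posdef_unitmx (R : realType) (n : nat) (S : 'M[R]_n) :
  posdef S -> S \in unitmx.
Proof.
move=> [_ pS]; rewrite -row_free_unit -kermx_eq0; apply/eqP/row_matrixP => i.
rewrite row0; apply/eqP; apply: contraT => x0.
have := pS (row i (kermx S))^T; rewrite trmxK -row_mul mulmx_ker row0 mul0mx.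
by rewrite mxE ltxx trmx_eq0 => /(_ x0).
Qed.

(** * Faces of the semidefinite cone *)

Lemma is_face_setI (R : realType) (W : lmodType R) (K F G : set W) :
  is_face K F -> is_face K G -> is_face K (F `&` G).
Proof.
move=> [FK hF] [_ hG]; split=> [x [Fx _]|x y Kx Ky [Fxy Gxy] z xyz].
  exact: FK.
by split; [exact: (hF x y)|exact: (hG x y)].
Qed.

(** If [(x + y) / 2] annihilates the columns of [M], the forms of [x] and [y]
    at each column are nonnegative with sum zero, hence both zero. *)
Lemma is_face_annihilated (R : realType) (n p : nat) (M : 'M[R]_(n, p)) :
  is_face (@psd R n) [set Y | psd Y /\ Y *m M = 0].
Proof.
split=> [Y []//|x y px py [pxy xyM] z xyz].
have dxy j : (M^T *m x *m M) j j + (M^T *m y *m M) j j = 0.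
  have : (M^T *m ((2^-1 *: (x + y)) *m M)) j j = 0 by rewrite xyM mulmx0 mxE.
  rewrite -scalemxAl -scalemxAr mulmxDl mulmxDr !mulmxA mxE [X in _ * X]mxE.
  by move/eqP; rewrite mulf_eq0 invr_eq0 pnatr_eq0 /= => /eqP.
have d0 w j : psd w -> 0 <= (M^T *m w *m M) j j.
  by move=> [_ pw]; rewrite -quad_col; exact: pw.
have xM : x *m M = 0.
  apply: psd_mulmx_eq0 => // j.
  by have := d0 x j px; have := d0 y j py; have := dxy j; lra.
have yM : y *m M = 0.
  apply: psd_mulmx_eq0 => // j.
  by have := d0 x j px; have := d0 y j py; have := dxy j; lra.
split; first exact: (psd_is_face R n).2 x y px py pxy z xyz.
have [a [b [_ _ ->]]] := xyz.
by rewrite mulmxDl -!scalemxAl xM yM !scaler0 addr0.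
Qed.

(** For symmetric [Y], annihilating the cokernel of [A^T] means that the row and
    the column space of [Y] lie in the range of [A]; multiplying [Y] on both
    sides by a partial inverse of [A] produces the middle factor.  This form
    exhibits [congr_psd A] as a face. *)
Lemma congr_psdE (R : realType) (n p : nat) (A : 'M[R]_(n, p)) :
  congr_psd A = [set Y | psd Y /\ Y *m cokermx A^T = 0].
Proof.
apply/seteqP; split=> [_ [Z pZ <-]|Y [pY /eqP]] /=.
  by split; [exact: psd_congr|rewrite -mulmxA mulmx_coker mulmx0].
rewrite -submxE => /mulmxKpV; move: (pinvmx A^T) => G YE.
have [sY _] := pY; exists (G^T *m Y *m G).
  by rewrite -{2}[G]trmxK; apply: psd_congr.
have AY : A *m G^T *m Y = Y.
  by have /(congr1 trmx) := YE; rewrite !trmx_mul trmxK (sY : _^T = _) mulmxA.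
by rewrite !mulmxA AY YE.
Qed.

Lemma is_face_congr_psd (R : realType) (n p : nat) (A : 'M[R]_(n, p)) :
  is_face (@psd R n) (congr_psd A).
Proof. by rewrite congr_psdE; exact: is_face_annihilated. Qed.

Lemma congr_psdI_centeredE (R : realType) (n p : nat) (A : 'M[R]_(n, p)) :
  congr_psd A `&` @centered R n =
  congr_psd A `&` [set Y | psd Y /\ Y *m onesv R n = 0].
Proof.
apply/seteqP; split=> Y [AY [pY Y0]]; split => //.
  by split => //; exact: (is_face_congr_psd A).1.
by split => //; case: pY.
Qed.

(** By [|y_i y_j| <= y^T y], the sum of the absolute values of the entries
    bounds the form on the unit sphere. *)
Lemma quad_bound (R : realType) (n : nat) (M : 'M[R]_n) :
  exists2 C : R, 0 < C &
    forall y : 'cV[R]_n, (y^T *m M *m y) 0 0 <= C * (y^T *m y) 0 0.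
Proof.
pose C := \sum_j \sum_i `|M i j|.
have C0 : 0 <= C by apply: sumr_ge0 => j _; apply: sumr_ge0.
(* Adding 1 makes the constant positive also for [M = 0]. *)
exists (C + 1) => [|y]; first by lra.
have le_sq i : y i 0 ^+ 2 <= (y^T *m y) 0 0.
  rewrite trmx_mul_self00 (bigD1 i) //= lerDl.
  by apply: sumr_ge0 => j _; exact: sqr_ge0.
apply: (@le_trans _ _ (C * (y^T *m y) 0 0)); last first.
  by rewrite ler_wpM2r ?gram_ge0 //; lra.
rewrite mxE mulr_suml; apply: ler_sum => j _.
rewrite mxE !mulr_suml; apply: ler_sum => i _; rewrite mxE.
apply: (le_trans (ler_norm _)); rewrite mulrAC mulrC normrM.
rewrite ler_wpM2l ?normr_ge0 // ler_norml.
have := le_sq i; have := le_sq j; have := sqr_ge0 (y i 0 + y j 0).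
have := sqr_ge0 (y i 0 - y j 0).
by move=> ? ? ? ?; apply/andP; split; nra.
Qed.

(** A face that meets the relative interior of a convex subset of the cone
    contains that subset, and [Q *m Q^T] is relatively interior to the psd
    matrices supported on the range of [Q].  With [C] a bound for the form of
    [M], the matrix [Q *m Q^T - C^-1 *: Y] is psd, so [Q *m Q^T] is the
    midpoint of two psd matrices, one of them a positive multiple of [Y]. *)
Lemma face_mem_range (R : realType) (n p : nat) (F : set 'M[R]_n)
    (Q : 'M[R]_(n, p)) (M : 'M[R]_p) :
  is_face (@psd R n) F -> F (Q *m Q^T) -> psd (Q *m M *m Q^T) ->
  F (Q *m M *m Q^T).
Proof.
move=> [_ hF] FQ pY; set Y := Q *m M *m Q^T in pY *.
have [C C0 bC] := quad_bound M.
have [sY qY] := pY; have [sQ _] := psd_gram Q.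
pose x := (2 / C) *: Y; pose y := 2 *: (Q *m Q^T) - x.
have C2 : 0 < 2 / C by rewrite divr_gt0.
have px : psd x.
  split=> [|v]; first by rewrite /symm /= linearZ /= (sY : _^T = _).
  by rewrite -scalemxAr -scalemxAl mxE mulr_ge0 // ltW.
have py : psd y.
  split=> [|v].
    rewrite /symm /y /x /= linearB /= !linearZ /=.
    by rewrite (sY : _^T = _) (sQ : _^T = _).
  have qE : v^T *m y *m v = 2 *: ((Q^T *m v)^T *m (Q^T *m v)) -
      (2 / C) *: ((Q^T *m v)^T *m M *m (Q^T *m v)).
    rewrite /y /x /Y mulmxBr mulmxBl -!scalemxAr -!scalemxAl trmx_mul trmxK.
    by rewrite !mulmxA.
  have := bC (Q^T *m v); rewrite -(ler_pM2l C2) mulrA divfK ?gt_eqF //.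
  rewrite qE; move: (_ *m M *m _) => a.
  move: (_ *m (Q^T *m v)) => b ab.
  by rewrite !mxE subr_ge0.
have Exy : 2^-1 *: (x + y) = Q *m Q^T.
  by rewrite /y addrC subrK scalerA mulVf ?scale1r ?pnatr_eq0.
apply: (hF x y) => //; first by rewrite Exy.
exists (C / 2), 0; split=> //; first by rewrite divr_ge0 ?ltW.
rewrite scale0r addr0 /x scalerA.
have -> : C / 2 * (2 / C) = 1 by field; rewrite gt_eqF.
by rewrite scale1r.
Qed.

(** * Distance matrices as images of Gram matrices *)

Lemma edmK_entry (R : realType) (n : nat) (Y : 'M[R]_n) i j :
  edmK Y i j = Y i i + Y j j - 2 * Y i j.
Proof. by rewrite !mxE !big_ord1 !mxE mulr1 mul1r. Qed.

Lemma ulsubmx_edmK (R : realType) (k m : nat) (Y : 'M[R]_(k + m)) :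
  ulsubmx (edmK Y) = edmK (ulsubmx Y).
Proof. by apply/matrixP => i j; rewrite !(mxE, edmK_entry). Qed.

Lemma edmK_gram_entry (R : realType) (n r : nat) (P : 'M[R]_(n, r)) i j :
  edmK (P *m P^T) i j = l2norm ((row i P)^T - (row j P)^T) ^+ 2.
Proof.
rewrite /l2norm sqr_sqrtr; last by apply: sumr_ge0 => l _; exact: sqr_ge0.
rewrite edmK_entry !mxE mulr_sumr -big_split /= -sumrB.
by apply: eq_bigr => l _; rewrite !mxE; ring.
Qed.

Lemma realizableP (R : realType) (n r : nat) (D : 'M[R]_n) :
  realizable D r <-> exists P : 'M[R]_(n, r), D = edmK (P *m P^T).
Proof.
split=> [[p Dp]|[P ->]]; last first.
  by exists (fun i => (row i P)^T) => i j; exact: edmK_gram_entry.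
exists (\matrix_(i, l) p i l 0); apply/matrixP => i j.
rewrite edmK_gram_entry Dp; congr (l2norm (_ - _) ^+ 2);
  by apply/matrixP => a b; rewrite ord1 !mxE.
Qed.

(** The pseudoinverse recovers the points up to translation, with the centroid
    put at the origin. *)
Lemma edmKdag_gram (R : realType) (n r : nat) (P : 'M[R]_(n, r)) :
  (0 < n)%N ->
  edmKdag (edmK (P *m P^T)) = (centering R n *m P) *m (centering R n *m P)^T.
Proof. by move=> n0; rewrite edmKdag_edmK // trmx_mul centering_tr !mulmxA. Qed.

Lemma centering_mulE (R : realType) (n p : nat) (A : 'M[R]_(n, p)) :
  centering R n *m A =
  A - onesv R n *m (n%:R^-1 *: ((onesv R n)^T *m A)).
Proof. by rewrite /centering mulmxBl mul1mx -scalemxAl -scalemxAr mulmxA. Qed.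

(** * The centered part of a face *)

Section ProjectedFace.
Variables (R : realType) (n p q : nat) (U : 'M[R]_(n, p)) (V : 'M[R]_(p, q)).
Let u := U^T *m onesv R n.
Hypothesis oV : orthogonal_mx (row_mx V ((l2norm u)^-1 *: u)).

Lemma orthogonal_last_col : V^T *m u = 0.
Proof.
have [+ _] := oV; rewrite tr_row_mx mul_col_row scalar_mx_block.
move=> /eq_block_mx[_ + _ dr]; rewrite -scalemxAr.
move=> /eqP; rewrite scaler_eq0 => /orP[/eqP c0|/eqP//].
(* A zero scaling factor would make the last column zero, not a unit vector. *)
move: dr; rewrite c0 scale0r mulmx0 => /matrixP /(_ 0 0); rewrite !mxE.
by move=> /esym/eqP; rewrite oner_eq0.
Qed.

Lemma orthogonal_kernel (Z : 'M[R]_p) : Z *m u = 0 -> Z = Z *m V *m V^T.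
Proof.
move=> Zu; have [_ +] := oV; rewrite tr_row_mx mul_row_col.
move=> /(congr1 (mulmx Z)).
rewrite mulmx1 mulmxDr (mulmxA Z (_ *: u)) -scalemxAr Zu scaler0 mul0mx addr0.
by rewrite mulmxA.
Qed.

(** Since [e^T *m (U *m Z *m U^T) *m e] is the form of [Z] at [u], being
    centered forces [Z *m u = 0]; then [Z] lives on the complement of [u],
    which [V] spans. *)
Lemma congr_psd_centered :
  congr_psd U `&` @centered R n = congr_psd (U *m V).
Proof.
apply/seteqP; split=> [_ [[Z pZ <-] [_ Ze]]|_ [Z pZ <-]].
  have Zu : Z *m u = 0.
    apply: psd_col_eq0 => //; rewrite /u trmx_mul trmxK.
    by rewrite -!mulmxA (mulmxA Z) (mulmxA U) (mulmxA U) Ze mulmx0 mxE.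
  have ZE := orthogonal_kernel Zu; have [sZ _] := pZ.
  exists (V^T *m Z *m V).
    by rewrite -{2}[V]trmxK; exact: psd_congr.
  have ZE' : Z = V *m V^T *m Z.
    by rewrite -{1}(sZ : _^T = _) {1}ZE !trmx_mul trmxK (sZ : _^T = _) mulmxA.
  rewrite trmx_mul !mulmxA; congr (_ *m _); rewrite -!mulmxA; congr (_ *m _).
  by rewrite !mulmxA -ZE' -ZE.
split; first by exists (V *m Z *m V^T);
  [exact: psd_congr|rewrite trmx_mul !mulmxA].
split; first by have [] := psd_congr (U *m V) pZ.
by rewrite trmx_mul -!mulmxA orthogonal_last_col !mulmx0.
Qed.

(** The columns of [U *m V] are orthogonal to [e], so centering fixes them. *)
Lemma centering_proj : centering R n *m (U *m V) = U *m V.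
Proof.
rewrite centering_mulE mulmxA.
have -> : (onesv R n)^T *m U = u^T by rewrite trmx_mul trmxK.
by rewrite -[u^T *m V]trmxK trmx_mul trmxK orthogonal_last_col trmx0 scaler0
  mulmx0 subr0.
Qed.

End ProjectedFace.

(** * Completions of a partial distance matrix *)

Section Completions.
Variables (R : realType) (k m t : nat).
Hypothesis k_gt0 : (0 < k)%N.
Variables (Ubar : 'M[R]_(k, t)) (S : 'M[R]_t) (Dbar : 'M[R]_k).
Hypothesis BE : edmKdag Dbar = Ubar *m S *m Ubar^T.
Let UB : 'M[R]_(k, t + 1) :=
  row_mx Ubar ((Num.sqrt k%:R)^-1 *: onesv R k).
Let U : 'M[R]_(k + m, t + 1 + m) := block_mx UB 0 0 1%:M.

(** The range of [U] is invariant under translations of the first [k] rows, and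
    its last [m] rows are unconstrained. *)
Lemma col_mx_range s (a : 'M[R]_(t, s)) (b : 'M[R]_(1, s)) (c : 'M[R]_(m, s)) :
  exists W, col_mx (Ubar *m a + onesv R k *m b) c = U *m W.
Proof.
have k0 : Num.sqrt k%:R != 0 :> R by rewrite sqrtr_eq0 -ltNge ltr0n.
exists (col_mx (col_mx a (Num.sqrt k%:R *: b)) c).
rewrite mul_block_col mul_row_col !mul0mx addr0 add0r mul1mx.
by rewrite -scalemxAl -scalemxAr scalerA mulVf // scale1r.
Qed.

(** The prescribed block determines the first [k] points up to isometry and
    translation, which confines their coordinates to the range of [Ubar] plus
    multiples of [e]. *)
Lemma edmKdag_completion_sub :
  @edmKdag R (k + m) @` @edm_completions R k m Dbar `<=`
  congr_psd U `&` @centered R (k + m).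
Proof.
have n_gt0 : (0 < k + m)%N by rewrite addn_gt0 k_gt0.
move=> _ [D [[s /realizableP[P DP]] DD] <-].
rewrite DP edmKdag_gram //; split; last first.
  split; first by have [] := psd_gram (centering R (k + m) *m P).
  rewrite -mulmxA [X in _ *m (X *m _)]trmx_mul centering_tr -!mulmxA.
  by rewrite centering_ones // !mulmx0.
suff [W ->] : exists W, centering R (k + m) *m P = U *m W.
  by exists (W *m W^T); [exact: psd_gram|rewrite trmx_mul !mulmxA].
have [W QW] : exists W, centering R k *m usubmx P = Ubar *m W.
  apply: (@gram_range _ _ _ _ _ _ (S *m Ubar^T)); rewrite mulmxA -BE -DD DP.
  rewrite -edmKdag_gram // ulsubmx_edmK; congr (edmKdag (edmK _)).
  apply/matrixP => i j; rewrite !mxE.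
  by apply: eq_bigr => l _; rewrite !mxE.
have -> : P = col_mx (Ubar *m W +
   onesv R k *m (k%:R^-1 *: ((onesv R k)^T *m usubmx P))) (dsubmx P).
  by rewrite -QW centering_mulE subrK vsubmxK.
have [W1 ->] := col_mx_range W (k%:R^-1 *: ((onesv R k)^T *m usubmx P))
  (dsubmx P).
have [w ew] : exists w, onesv R (k + m) = U *m w.
  (* The all-ones vector is itself a translation of zero. *)
  have [w ew] := col_mx_range 0 1%:M (onesv R m).
  by exists w; rewrite -ew mulmx0 add0r mulmx1 /onesv -col_mx_const.
by rewrite centering_mulE {1}ew -mulmxA -mulmxBr; eexists.
Qed.

(** The block matrix holds the points of a completion of largest possible
    dimension: the first [k] realize [Dbar] in the first [t] coordinates, the
    others are the unit vectors of [m] further coordinates.  Up to multiples of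
    [e], which centering kills, its range contains that of [U]. *)
Lemma spread_range (P : 'M[R]_(k, t)) :
  Dbar = edmK (P *m P^T) -> Ubar^T *m Ubar = 1%:M -> S \in unitmx ->
  exists N, centering R (k + m) *m U =
    centering R (k + m) *m (block_mx P 0 0 1%:M : 'M_(k + m, t + m)) *m N.
Proof.
move=> DP UU uS.
have n_gt0 : (0 < k + m)%N by rewrite addn_gt0 k_gt0.
have [W [d UBE]] : exists W d, UB = P *m W + onesv R k *m d.
  (* [J *m P *m W = B *m Ubar *m S^-1], and [B *m Ubar = Ubar *m S]. *)
  pose W := (centering R k *m P)^T *m Ubar *m invmx S.
  have UW : Ubar = centering R k *m (P *m W).
    rewrite /W !mulmxA -edmKdag_gram // -DP BE.
    by rewrite -!mulmxA (mulmxA Ubar^T) UU mul1mx mulmxV // mulmx1.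
  exists (row_mx W 0), (row_mx (- (k%:R^-1 *: ((onesv R k)^T *m (P *m W))))
    ((Num.sqrt k%:R)^-1%:M)).
  rewrite !mul_mx_row add_row_mx mulmx0 add0r mul_mx_scalar mulmxN.
  by rewrite -centering_mulE -UW.
(* Adding [e *m d] to all rows corrects the first [k]; the lower left block
   undoes this on the last [m]. *)
exists (block_mx W 0 (- (onesv R m *m d)) 1%:M).
rewrite -mulmxA mulmx_block !mulmx0 !mul0mx !addr0 !add0r !mul1mx.
have -> : U = block_mx (P *m W) 0 (- (onesv R m *m d)) 1%:M +
    onesv R (k + m) *m row_mx d 0.
  rewrite /onesv -col_mx_const mul_col_row add_block_mx !mulmx0 !addr0.
  by rewrite addNr /U UBE.
by rewrite mulmxDr mulmxA centering_ones // mul0mx addr0.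
Qed.

End Completions.

Theorem theorem2p3 (R : realType) (k m r t : nat) (k_ge1 : (1 <= k)%N)
    (D : 'M[R]_(k + m)) (edmD : edm D) (dimD : embedding_dim D r)
    (Ubar : 'M[R]_(k, t)) (S : 'M[R]_t)
    (V : 'M[R]_(t + 1 + m, t + m)) :
  let Dbar : 'M[R]_k := ulsubmx D in
  let B : 'M[R]_k := edmKdag Dbar in
  let UB : 'M[R]_(k, t + 1) :=
    row_mx Ubar ((Num.sqrt k%:R)^-1 *: onesv R k) in
  let U : 'M[R]_(k + m, t + 1 + m) := block_mx UB 0 0 1%:M in
  let u : 'cV[R]_(t + 1 + m) := U^T *m onesv R (k + m) in
  embedding_dim Dbar t ->
  B = Ubar *m S *m Ubar^T ->
  Ubar^T *m Ubar = 1%:M ->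
  posdef S ->
  orthogonal_mx (row_mx V ((l2norm u)^-1 *: u)) ->
  face (@edmKdag R (k + m) @` @edm_completions R k m Dbar)
    = congr_psd U `&` @centered R (k + m) /\
  congr_psd U `&` @centered R (k + m) = congr_psd (U *m V).
Proof.
move=> Dbar B UB U u [/realizableP[P DP] _] BE UU pS oV.
have n_gt0 : (0 < k + m)%N by rewrite addn_gt0 k_ge1.
have UVE := congr_psd_centered oV; split=> //.
apply/seteqP; split.
  apply: smallest_sub; last exact: (edmKdag_completion_sub k_ge1 BE).
  rewrite congr_psdI_centeredE; apply: is_face_setI.
    exact: is_face_congr_psd.
  exact: is_face_annihilated.
rewrite UVE => _ [Z pZ <-] F [faceF subF].
have [N JU] := spread_range m k_ge1 BE DP UU (posdef_unitmx pS).
have UVN := centering_proj oV; rewrite mulmxA JU -mulmxA in UVN.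
set Q := centering R (k + m) *m _ in UVN.
have pY := psd_congr (U *m V) pZ; move: pY; rewrite -UVN.
have -> : Q *m (N *m V) *m Z *m (Q *m (N *m V))^T =
    Q *m (N *m V *m Z *m (N *m V)^T) *m Q^T by rewrite trmx_mul !mulmxA.
apply: face_mem_range => //; apply: subF.
rewrite /Q -edmKdag_gram //; eexists; last reflexivity.
split; first by exists (t + m)%N; apply/realizableP; eexists.
rewrite ulsubmx_edmK DP; congr edmK.
rewrite tr_block_mx !trmx0 mulmx_block block_mxKul.
by rewrite mul0mx addr0.
Qed.
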